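(* Let $b\geq 2$ be an integer, $\mathcal{A}=\{0,\dots,b-1\}$, $k$ a positive integer and $r$ a positive integer coprime with $b$. Identify each word in $\mathcal{A}^k$ with an integer modulo $b^k$ via its base-$b$ representation (with $k$ digits). Let $s$ be the word of length $kb^k$ obtained by concatenating the words of $\mathcal{A}^k$ corresponding to $0, r, 2r, \dots, (b^k-1)r$ (taken modulo $b^k$), in this order. Then the necklace $[s]$ is $(k,k)$-perfect.
   Context: A necklace is the equivalence class of a word under cyclic rotations. A word $u$ of length $k$ occurs in a necklace $[s]$ (with $|s|=N$) at position $i$ if $s((i+t)\bmod N)=u(t)$ for $t=0,\dots,k-1$. A necklace is $(k,n)$-perfect if it has length $n|\mathcal{A}|^k$ and each word of length $k$ occurs in it exactly $n$ times, at positions that are pairwise different modulo $n$. A necklace is called perfect if it is $(k,k)$-perfect for some $k$. *)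

(* Defs.v *)
From mathcomp Require Import all_boot.
From mathcomp Require Import generic_quotient.

Set Implicit Arguments.
Unset Strict Implicit.
Unset Printing Implicit Defensive.

Section Necklace.
Variable A : finType.
Implicit Types (s t u : seq A).

Definition rot_equiv : rel (seq A) :=
  fun s t => t \in [seq rot i s | i <- iota 0 (size s).+1].

Lemma rot_equivP s t :
  reflect (exists2 i, i <= size s & t = rot i s) (rot_equiv s t).
Proof.
apply: (iffP mapP) => -[i hi ->]; exists i => //.
  by move: hi; rewrite mem_iota.
by rewrite mem_iota.
Qed.

Lemma rot_equiv_is_equiv : equiv_class_of rot_equiv.
Proof.
have sym s t : rot_equiv s t -> rot_equiv t s.
  case/rot_equivP=> i le_is ->; apply/rot_equivP.
  exists (size (rot i s) - i); first exact: leq_subr.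
  by rewrite -{1}(rotK i s).
split=> [s|s t|t s u].
- by apply/rot_equivP; exists 0; rewrite ?rot0.
- by apply/idP/idP; apply: sym.
case/rot_equivP=> i le_is -> /rot_equivP[j]; rewrite size_rot => le_js ->.
apply/rot_equivP; rewrite rot_add_mod //; set m := (X in rot X s).
by exists m; rewrite // /m; case: ifP => // _; rewrite leq_subLR leq_add.
Qed.

Canonical rot_equiv_equiv := EquivRelPack rot_equiv_is_equiv.
Canonical rot_equiv_encModRel := defaultEncModRel rot_equiv.

Definition necklace := {eq_quot rot_equiv}%qT.

Definition necklace_of s : necklace := (\pi_necklace s)%qT.

(* The position i + j is reduced modulo the length of s, so occurrences may
   wrap around s, several times if u is longer than s. *)
Definition occurs_at s u i : bool :=
  all (fun j => onth s ((i + j) %% size s) == onth u j) (iota 0 (size u)).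

Definition positions s u : seq nat :=
  [seq i <- iota 0 (size s) | occurs_at s u i].

(* Rotating s translates all positions modulo its length, a multiple of n, so
   the condition does not depend on the representative s of the necklace; it is
   required of all of them. *)
Definition perfect_necklace (k n : nat) (x : necklace) : Prop :=
  forall s, necklace_of s = x ->
    size s = n * #|A| ^ k /\
    forall u : k.-tuple A,
      size (positions s u) = n /\
      {in positions s u &, injective (fun i => i %% n)}.

End Necklace.

Section BaseWords.
Variables (b : nat) (hb : 1 < b).

Definition digit (m : nat) : 'I_b := Ordinal (ltn_pmod m (ltnW hb)).

(* Most significant digit first. *)
Definition base_word (k m : nat) : k.-tuple 'I_b :=
  [tuple digit (m %/ b ^ (k - j.+1)) | j < k].

Definition base_value (k : nat) (w : k.-tuple 'I_b) : nat :=
  \sum_(j < k) tnth w j * b ^ (k - j.+1).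

Lemma base_word_value (k m : nat) :
  base_value (base_word k m) = m %% b ^ k.
Proof.
rewrite /base_value; under eq_bigr => j _ do rewrite tnth_mktuple /=.
rewrite (reindex_inj rev_ord_inj) /=.
under eq_bigr => j _ do rewrite subnSK // subKn 1?ltnW //.
elim: k => [|k IHk]; first by rewrite big_ord0 modn1.
rewrite big_ord_recr /= IHk.
rewrite {3}(divn_eq m (b ^ k)) {2}(divn_eq (m %/ b ^ k) b).
have b0 : 0 < b by exact: ltnW.
rewrite mulnDl -mulnA -expnS -addnA modnMDl [RHS]modn_small; first by rewrite addnC.
apply: (@leq_trans (((m %/ b ^ k) %% b).+1 * b ^ k)).
  by rewrite mulSn addnC ltn_add2r ltn_pmod ?expn_gt0 ?b0.
by rewrite expnS leq_mul2r ltn_pmod ?orbT.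
Qed.

Definition arith_word (k r : nat) : seq 'I_b :=
  flatten [seq tval (base_word k ((i * r) %% b ^ k)) | i <- iota 0 (b ^ k)].

End BaseWords.

(* Main.v *)
Require Import Defs.
From mathcomp Require Import all_boot.
From mathcomp Require Import generic_quotient zify.

(** In a word of length [n * #|A| ^ k], send a position [i] to the pair
    ([i] mod [n], word of length [k] read at [i]).  Both sides have the same
    cardinality, so the map is a bijection, and the necklace is perfect, as
    soon as it is injective.  For the arithmetic word and [n = k], let
    [i = q * k + m]: the word read at [i] consists of the [k - m] low digits of
    [q * r] followed by the [m] high digits of [q.+1 * r].  Adding [r], the
    former determine the [k - m] low digits of [q.+1 * r], so the whole of
    [q.+1 * r] modulo [b ^ k] is known; as [r] is invertible modulo [b ^ k], so
    is [q]. *)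

Set Implicit Arguments.
Unset Strict Implicit.
Unset Printing Implicit Defensive.

Lemma eqn_mod_coprimeMr (d r m n : nat) :
  coprime d r -> (m * r == n * r %[mod d]) = (m == n %[mod d]).
Proof.
move=> co_dr; wlog le_nm : m n / n <= m => [le_case|].
  case: (leqP n m) => [/le_case //|/ltnW/le_case].
  by rewrite eq_sym => ->; rewrite eq_sym.
by rewrite !eqn_mod_dvd ?leq_mul2r ?le_nm ?orbT // -mulnBl Gauss_dvdl.
Qed.

Section CyclicReading.
Variable T : Type.
Implicit Types (s : seq T) (ss : seq (seq T)).

Definition cyclic_onth s (i : nat) : option T := onth s (i %% size s).

Lemma cyclic_onth_rot s (m i : nat) :
  m <= size s -> cyclic_onth (rot m s) i = cyclic_onth s (i + m).
Proof.
case: s => [|x s].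
  by rewrite leqn0 => /eqP->; rewrite rot0 /cyclic_onth !onth0n.
set s' := x :: s => le_ms.
rewrite /cyclic_onth size_rot -(modnDml i); set j := i %% _.
have lt_js : j < size s' by rewrite ltn_mod.
rewrite !onthE map_rot nth_cat size_drop size_map.
case: ltnP => [lt_j|le_j]; first by rewrite nth_drop addnC modn_small //; lia.
rewrite nth_take; last lia.
have -> : j + m = j - (size s' - m) + size s' by lia.
by rewrite modnDr modn_small //; lia.
Qed.

Lemma size_flatten_uniform (k : nat) ss :
  all (fun s => size s == k) ss -> size (flatten ss) = size ss * k.
Proof.
elim: ss => //= s ss IHss /andP[/eqP sz_s /IHss sz_flat].
by rewrite size_cat sz_s sz_flat.
Qed.

Lemma onth_flatten_uniform (k q m : nat) ss :
    all (fun s => size s == k) ss -> m < k ->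
  onth (flatten ss) (q * k + m) = onth (nth [::] ss q) m.
Proof.
move=> + lt_mk; elim: ss q => [|s ss IHss] q /=.
  by rewrite nth_nil !onth0n.
case/andP=> /eqP sz_s sz_ss; rewrite onth_cat sz_s.
case: q => [|q]; first by rewrite lt_mk.
by rewrite mulSn -addnA ltnNge leq_addr addKn IHss.
Qed.

Lemma cyclic_onth_flatten_uniform (k q m : nat) ss :
    all (fun s => size s == k) ss -> m < k ->
  cyclic_onth (flatten ss) (q * k + m) = onth (nth [::] ss (q %% size ss)) m.
Proof.
case: ss => [|s ss]; first by rewrite /cyclic_onth nth_nil !onth0n.
set ss' := s :: ss => sz_ss lt_mk.
rewrite /cyclic_onth (size_flatten_uniform sz_ss).
rewrite -modnDml -muln_modl modn_small.
  exact: onth_flatten_uniform.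
rewrite (@leq_trans ((q %% size ss').+1 * k)) ?leq_mul2r ?ltn_mod ?orbT //.
by rewrite mulSn addnC ltn_add2r.
Qed.

End CyclicReading.

Section Occurrences.
Variable A : finType.
Implicit Types (s u : seq A).

Lemma occurs_atP s u (i : nat) :
  reflect (forall t, t < size u -> cyclic_onth s (i + t) = onth u t)
          (occurs_at s u i).
Proof.
apply: (iffP allP) => [occ t lt_tu|occ t].
  by apply/eqP/occ; rewrite mem_iota.
by rewrite mem_iota => /= /occ/eqP.
Qed.

Lemma occurs_at_rot s u (m i : nat) :
  m <= size s -> occurs_at (rot m s) u i = occurs_at s u (i + m).
Proof.
move=> le_ms; apply/occurs_atP/occurs_atP => occ t /occ <-;
  by rewrite cyclic_onth_rot // addnAC.
Qed.

Lemma exists_occurs_at (k : nat) s (i : nat) :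
  0 < size s -> exists u : k.-tuple A, occurs_at s u i.
Proof.
move=> s_gt0.
pose pos t : 'I_(size s) := Ordinal (ltn_pmod (i + t) s_gt0).
pose letter t := tnth (in_tuple s) (pos t).
exists [tuple letter t | t < k]; apply/occurs_atP => t.
rewrite size_tuple => lt_tk.
have /tnth_onth -> : tnth [tuple letter t | t < k] (Ordinal lt_tk) = letter t.
  by rewrite tnth_mktuple.
exact/(tnth_onth _ (in_tuple s) (pos t)).
Qed.

Definition separated_occurrences (k n : nat) s : Prop :=
  forall (u : k.-tuple A) i j, occurs_at s u i -> occurs_at s u j ->
    i = j %[mod n] -> i = j %[mod size s].

Lemma separated_occurrences_rot (k n m : nat) s :
    m <= size s ->
  separated_occurrences k n s -> separated_occurrences k n (rot m s).
Proof.
move=> le_ms sep u i j; rewrite !occurs_at_rot // size_rot => occ_i occ_j eq_ij.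
apply/eqP; rewrite -(eqn_modDr m); apply/eqP/(sep u) => //.
by rewrite -modnDml eq_ij modnDml.
Qed.

Section Separated.
Variables (k n : nat) (s : seq A).
Hypothesis sep_s : separated_occurrences k n s.

Lemma positions_modn_inj (u : k.-tuple A) :
  {in positions s u &, injective (fun i => i %% n)}.
Proof.
move=> i j; rewrite !mem_filter !mem_iota.
move=> /andP[occ_i /= lt_i] /andP[occ_j /= lt_j].
by move=> /(sep_s occ_i occ_j); rewrite !modn_small.
Qed.

Hypothesis size_s : size s = n * #|A| ^ k.

Lemma positions_modn_surj (u : k.-tuple A) (m : nat) :
  m < n -> exists2 i, i \in positions s u & i %% n = m.
Proof.
move=> lt_mn; have n_gt0 : 0 < n by exact: leq_ltn_trans lt_mn.
have s_gt0 : 0 < size s.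
  by rewrite size_s muln_gt0 n_gt0 -card_tuple; apply/card_gt0P; exists u.
pose word_at i : k.-tuple A := xchoose (exists_occurs_at k i s_gt0).
have occ_word_at i : occurs_at s (word_at i) i.
  exact: (xchooseP (exists_occurs_at k i s_gt0)).
pose g (i : 'I_(size s)) := (Ordinal (ltn_pmod i n_gt0), word_at i).
have g_inj : injective g.
  move=> i j [eq_mod eq_word]; apply: val_inj => /=.
  rewrite -(modn_small (ltn_ord i)) -(modn_small (ltn_ord j)).
  by apply: (sep_s (occ_word_at i)) eq_mod; rewrite eq_word; apply: occ_word_at.
have le_card : #|{: 'I_n * k.-tuple A}| <= #|'I_(size s)|.
  by rewrite card_prod card_tuple !card_ord size_s.
have /codomP[i [def_m def_u]] := inj_card_onto g_inj le_card (Ordinal lt_mn, u).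
exists (val i) => //.
by rewrite mem_filter mem_iota leq0n add0n ltn_ord andbT def_u occ_word_at.
Qed.

Lemma size_positions (u : k.-tuple A) : size (positions s u) = n.
Proof.
rewrite -(size_map (fun i => i %% n)) -[RHS](size_iota 0 n).
apply/perm_size/uniq_perm; rewrite ?iota_uniq //.
  by rewrite (map_inj_in_uniq (@positions_modn_inj u)) filter_uniq ?iota_uniq.
move=> m; rewrite mem_iota /=; apply/mapP/idP => [[i + ->]|].
  rewrite mem_filter mem_iota size_s ltn_mod => /and3P[_ _].
  by move/(leq_ltn_trans (leq0n i)); rewrite muln_gt0 => /andP[].
by case/(positions_modn_surj u) => i pos_i <-; exists i.
Qed.

End Separated.

Lemma separated_occurrences_perfect (k n : nat) s :
    size s = n * #|A| ^ k -> separated_occurrences k n s ->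
  perfect_necklace k n (necklace_of s).
Proof.
move=> size_s sep_s _ /esym/eqmodP/rot_equivP[m le_ms ->].
have sep_rot := separated_occurrences_rot le_ms sep_s.
rewrite size_rot; split=> // u; split; last exact: positions_modn_inj.
by apply: size_positions; rewrite ?size_rot.
Qed.

End Occurrences.

Section Digits.
Variables (b : nat) (hb : 1 < b).

Definition place_digit (x d : nat) : 'I_b := digit hb (x %/ b ^ d).

Lemma onth_base_word (k x d : nat) :
  d < k -> onth (base_word hb k x) (k - d.+1) = Some (place_digit x d).
Proof.
move=> lt_dk; have lt_pk : k - d.+1 < k by lia.
apply/(tnth_onth _ (base_word hb k x) (Ordinal lt_pk)).
by rewrite tnth_mktuple /= subnSK // subKn // ltnW.
Qed.

Lemma eqn_mod_place_digitP (k x y : nat) :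
  x = y %[mod b ^ k] <-> forall d, d < k -> place_digit x d = place_digit y d.
Proof.
split=> [eq_xy d lt_dk|eq_digits].
  apply: val_inj; rewrite /= !modn_divl -expnS.
  have dvd_bb : b ^ d.+1 %| b ^ k by rewrite dvdn_exp2l.
  by rewrite -(modn_dvdm x dvd_bb) eq_xy modn_dvdm.
rewrite -!(base_word_value hb); congr base_value.
apply: eq_from_tnth => j; rewrite !tnth_mktuple; apply: eq_digits.
by have := ltn_ord j; lia.
Qed.

Lemma place_digit_overlap_inj (k l r x y : nat) :
    coprime r b ->
    (forall d, d < l -> place_digit (x * r) d = place_digit (y * r) d) ->
    (forall d, l <= d < k ->
       place_digit (x.+1 * r) d = place_digit (y.+1 * r) d) ->
  x = y %[mod b ^ k].
Proof.
move=> co_rb /eqn_mod_place_digitP low high.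
have lowS : x.+1 * r = y.+1 * r %[mod b ^ l].
  by rewrite !mulSn -modnDmr low modnDmr.
have eqS : x.+1 * r = y.+1 * r %[mod b ^ k].
  apply/eqn_mod_place_digitP => d lt_dk; case: (ltnP d l) => [lt_dl|le_ld].
    by move/eqn_mod_place_digitP: lowS; apply.
  by apply: high; rewrite le_ld.
have co_bkr : coprime (b ^ k) r by rewrite coprime_sym coprimeXr.
move/eqP: eqS; rewrite eqn_mod_coprimeMr // -(addn1 x) -(addn1 y) eqn_modDr.
by move/eqP.
Qed.

Section ArithWord.
Variables (k r : nat).

Lemma base_words_uniform :
  all (fun s => size s == k)
      [seq tval (base_word hb k (i * r %% b ^ k)) | i <- iota 0 (b ^ k)].
Proof. by apply/allP => _ /mapP[i _ ->]; rewrite size_tuple. Qed.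

Lemma size_arith_word : size (arith_word hb k r) = k * b ^ k.
Proof.
by rewrite (size_flatten_uniform base_words_uniform) size_map size_iota mulnC.
Qed.

Lemma cyclic_onth_arith_word (q d : nat) :
    d < k ->
  cyclic_onth (arith_word hb k r) (q * k + (k - d.+1)) =
    Some (place_digit (q * r) d).
Proof.
move=> lt_dk; have bk_gt0 : 0 < b ^ k by rewrite expn_gt0 (ltnW hb).
rewrite (cyclic_onth_flatten_uniform _ base_words_uniform); last by lia.
rewrite size_map size_iota (nth_map 0) ?size_iota ?nth_iota ?ltn_mod //.
rewrite onth_base_word //; congr Some.
apply: (eqn_mod_place_digitP k _ _).1 lt_dk.
by rewrite modn_mod modnMml.
Qed.

Lemma arith_word_separated :
  0 < k -> coprime r b -> separated_occurrences k k (arith_word hb k r).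
Proof.
move=> k_gt0 co_rb u i j /occurs_atP occ_i /occurs_atP occ_j eq_ij.
have same_letter t : t < k ->
    cyclic_onth (arith_word hb k r) (i + t) =
    cyclic_onth (arith_word hb k r) (j + t).
  by move=> lt_tk; rewrite occ_i ?occ_j ?size_tuple.
move: same_letter; rewrite size_arith_word (divn_eq i k) (divn_eq j k) -eq_ij.
set x := i %/ k; set y := j %/ k; set m := i %% k => same_letter.
have lt_mk : m < k by rewrite ltn_mod.
suff eq_xy : x = y %[mod b ^ k].
  by rewrite -modnDml -[RHS]modnDml (mulnC k) -!muln_modl eq_xy.
apply: (@place_digit_overlap_inj k (k - m) r) => // d.
- move=> lt_d; have lt_dk : d < k by lia.
  have same_block p : p * k + (k - d.+1) = p * k + m + (k - d.+1 - m) by lia.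
  apply: Some_inj; rewrite -!cyclic_onth_arith_word // !same_block.
  by apply: same_letter; lia.
- case/andP=> le_d lt_dk.
  have next_block p : p.+1 * k + (k - d.+1) = p * k + m + (k - m + (k - d.+1)).
    by rewrite mulSn; lia.
  apply: Some_inj; rewrite -!cyclic_onth_arith_word // !next_block.
  by apply: same_letter; lia.
Qed.

End ArithWord.
End Digits.

Theorem theorem2p3 (b k r : nat) (hb : 1 < b) (hk : 0 < k) (hr : 0 < r)
    (hrb : coprime r b) :
  perfect_necklace k k (necklace_of (arith_word hb k r)).
Proof.
apply: separated_occurrences_perfect; last exact: arith_word_separated.
by rewrite size_arith_word card_ord.
Qed.
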